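(* Let $G=\Theta_{1,2,2}$, or $G=\Theta_{p,p,q}$ with integers $2\leq p\leq 3$ and $p\leq q\leq p+2$. Then $\mathrm{edim}(G)=2c(G)-1$.
   Context: All graphs are finite, simple and connected. For positive integers $p\le q\le r$ (with $q\ge 2$, so that the graph is simple), $\Theta_{p,q,r}$ denotes the graph consisting of two distinct vertices $u,v$ joined by three internally vertex-disjoint paths of lengths (numbers of edges) $p$, $q$ and $r$. For vertices $x,y$ of a graph $G$, $d(x,y)$ is the length of a shortest path between them; for a vertex $x$ and an edge $e=yz$, $d(x,e)=\min\{d(x,y),d(x,z)\}$. A vertex $s$ distinguishes two edges $e,e'$ if $d(s,e)\neq d(s,e')$. A set $S\subseteq V(G)$ is an edge metric generator if every pair of distinct edges of $G$ is distinguished by some $s\in S$. The edge metric dimension $\mathrm{edim}(G)$ is the size of a smallest edge metric generator of $G$. The cyclomatic number of $G$ is $c(G)=|E(G)|-|V(G)|+1$. *)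

(* Defs.v *)
From mathcomp Require Import all_boot.

Set Implicit Arguments.
Unset Strict Implicit.
Unset Printing Implicit Defensive.

Record cgraph := CGraph {
  vertex :> finType;
  adj : rel vertex;
  adj_sym : symmetric adj;
  adj_irrefl : irreflexive adj;
  adj_connected : forall x y, connect adj x y
}.

Definition isomorphic (G H : cgraph) : Prop :=
  exists2 f : G -> H, bijective f & forall x y, adj (f x) (f y) = adj x y.

Section EdgeMetricDimension.

Variable G : cgraph.
Implicit Types (x y s : G) (e f : {set G}) (S : {set G}).

Definition edges : {set {set G}} :=
  [set [set xy.1; xy.2] | xy : G * G & adj xy.1 xy.2].

Definition cyclomatic : nat := (#|edges| + 1) - #|G|.

Definition has_path x y (n : nat) : bool :=
  [exists p : n.-tuple G,
    [&& path (@adj G) x p, uniq (x :: p) & last x p == y]].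

(* [find] returns the least [n] with [has_path x y n]; it lies below #|G|
   because a path has no repeated vertex and G is connected. *)
Definition dist x y : nat := find (has_path x y) (iota 0 #|G|).

(* The index #|G| exceeds every distance, hence is neutral for [minn] here. *)
Definition edge_dist x e : nat := \big[minn/#|G|]_(y in e) dist x y.

Definition distinguishes s e f : bool := edge_dist s e != edge_dist s f.

Definition edge_metric_generator S : bool :=
  [forall e in edges, forall f in edges,
    (e != f) ==> [exists s in S, distinguishes s e f]].

(* The full vertex set is a generator: an endpoint of one of two distinct edges
   that does not lie on the other distinguishes them. *)
Definition edim : nat :=
  #|[arg min_(S < [set: G] | edge_metric_generator S) #|S|]|.

End EdgeMetricDimension.

Section Theta.

Variables p q r : nat.

(* [true] and [false] are the two branch vertices u and v; the other three
   summands are the inner vertices of the three paths: a path of length n > 0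
   has n.-1 of them. As a path of length 1 is the edge uv, at most one of p, q, r
   may be 1. *)
Definition theta_vertex : finType :=
  (bool + ('I_p.-1 + 'I_q.-1 + 'I_r.-1))%type.

Definition theta_u : theta_vertex := inl true.
Definition theta_v : theta_vertex := inl false.

Definition theta_branch n (inner : 'I_n -> theta_vertex) : seq theta_vertex :=
  theta_u :: rcons (codom inner) theta_v.

Definition theta_branches : seq (seq theta_vertex) :=
  [:: theta_branch (fun i : 'I_p.-1 => inr (inl (inl i)));
      theta_branch (fun i : 'I_q.-1 => inr (inl (inr i)));
      theta_branch (fun i : 'I_r.-1 => inr (inr i))].

Definition consecutive (s : seq theta_vertex) : rel theta_vertex :=
  fun x y => (x, y) \in zip s (behead s).

Definition theta_adj : rel theta_vertex := fun x y =>
  has (fun s => consecutive s x y || consecutive s y x) theta_branches.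

Lemma theta_adj_sym : symmetric theta_adj.
Proof. by move=> x y; apply: eq_has => s; rewrite orbC. Qed.

Lemma consecutive_irrefl s : uniq s -> irreflexive (consecutive s).
Proof.
case: s => [|a s] //= U x; rewrite /consecutive /=.
elim: s a U => [|b s IH] a //= /andP[anbs U].
rewrite inE IH // orbF; apply/negP => /eqP[xa xb].
by rewrite inE -xa -xb eqxx in anbs.
Qed.

Lemma theta_branch_uniq n (g : 'I_n -> 'I_p.-1 + 'I_q.-1 + 'I_r.-1) :
  injective g -> uniq (theta_branch (fun i => inr (g i))).
Proof.
move=> gI; rewrite /= mem_rcons inE rcons_uniq /=.
rewrite map_inj_uniq ?enum_uniq ?andbT; last by move=> i j [/gI].
by apply/andP; split; apply/negP => /codomP[].
Qed.

Lemma theta_adj_irrefl : irreflexive theta_adj.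
Proof.
move=> x; rewrite /theta_adj /= !orbb.
rewrite !consecutive_irrefl //; apply: theta_branch_uniq => i j; congruence.
Qed.

Lemma consecutive_path a s : path (consecutive (a :: s)) a s.
Proof.
elim: s a => [|b s IH] a //=; rewrite {1}/consecutive /= inE eqxx /=.
by apply: sub_path (IH b) => x y; rewrite /consecutive /= inE orbC => ->.
Qed.

Lemma theta_branch_connect s x :
  s \in theta_branches -> x \in s -> connect theta_adj theta_u x.
Proof.
move=> sB; have [t Es] : exists t, s = theta_u :: t.
  by move: sB; rewrite !inE => /or3P[] /eqP->; eexists.
rewrite Es => xs; apply: (@path_connect _ theta_adj theta_u t) => //.
apply: sub_path (consecutive_path theta_u t) => y z yz.
by apply/hasP; exists s; rewrite // Es yz.
Qed.

Lemma theta_connected x y : connect theta_adj x y.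
Proof.
have from_u z : connect theta_adj theta_u z.
  case: z => [[]|[[i|i]|i]]; first exact: connect0.
  - apply: (@theta_branch_connect (nth [::] theta_branches 0)) => //.
      by rewrite mem_nth.
    by rewrite /= inE mem_rcons mem_head orbT.
  - apply: (@theta_branch_connect (nth [::] theta_branches 0)); first exact: mem_nth.
    by rewrite /= inE mem_rcons inE codom_f !orbT.
  - apply: (@theta_branch_connect (nth [::] theta_branches 1)); first exact: mem_nth.
    by rewrite /= inE mem_rcons inE (codom_f (fun i : 'I_q.-1 => _)) !orbT.
  - apply: (@theta_branch_connect (nth [::] theta_branches 2)); first exact: mem_nth.
    by rewrite /= inE mem_rcons inE (codom_f (fun i : 'I_r.-1 => _)) !orbT.
apply: connect_trans (from_u y).
by rewrite (sym_connect_sym theta_adj_sym).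
Qed.

Definition theta : cgraph :=
  CGraph theta_adj_sym theta_adj_irrefl theta_connected.

End Theta.

(* Main.v *)
From HB Require Import structures.
Require Import Defs.
From mathcomp Require Import all_boot.

Set Implicit Arguments.
Unset Strict Implicit.
Unset Printing Implicit Defensive.

(** The dimension is three by a finite verification, made uniform over the seven
    graphs.  Let u be a branch vertex.  In each of them the set formed by u and
    its neighbours on two branches of equal length is an edge metric generator,
    so three landmarks suffice; on the other hand every pair of vertices leaves
    two edges undistinguished.  As a theta graph has one edge more than it has
    vertices, c(G) = 2 and 2c(G) - 1 = 3.

    These facts are checked by evaluation, which needs a model of the graph that
    reduces.  Given a numbering c of the vertices of G by 0, ..., n-1 that turns
    adjacency into a relation a on natural numbers, distances in G are found by
    growing balls ([dist_numbering]), edges are pairs i < j with a i j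
    ([edges_numbering]), and a set of vertices is an edge metric generator
    exactly when the vectors of distances from its members to the edges are
    pairwise distinct ([edge_metric_generator_numbering]).  Hence [edim] is the
    least size of a resolving list of numbers ([edim_numbering]).  Every theta
    graph, and so every graph isomorphic to one, has such a numbering with an
    explicit a ([theta_num_adj]). *)

(** * Two facts on sequences *)

Lemma uniq_map_inj (S T : eqType) (f : S -> T) (s : seq S) :
  uniq (map f s) -> {in s &, injective f}.
Proof.
elim: s => //= x s IHs /andP[fx Us] y z /[!inE].
case/predU1P=> [->|ys] /predU1P[->|zs] // eyz; last exact: IHs eyz.
- by case/negP: fx; rewrite eyz map_f.
- by case/negP: fx; rewrite -eyz map_f.
Qed.

Lemma zip_map_pair (S T : Type) (f : S -> T) (s t : seq S) :
  zip (map f s) (map f t) = map (fun xy => (f xy.1, f xy.2)) (zip s t).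
Proof. by elim: s t => [|x s IHs] [|y t] //=; rewrite IHs. Qed.

(** * Distances and resolving lists in a graph on numbers *)

Section NumberedGraph.

Variables (n : nat) (a : rel nat).

(** The numbers at distance at most k from i in the graph on 0, ..., n-1 with
    adjacency a. *)
Definition ball k i : seq nat :=
  iter k (fun s => [seq j <- iota 0 n | (j \in s) || has (a^~ j) s]) [:: i].

(** The value is n when j is not reached from i, which does not happen in a
    connected graph. *)
Definition ndist i j : nat := find (fun k => j \in ball k i) (iota 0 n).

(** Each edge is listed once, as a pair (i, j) with i < j. *)
Definition nedges : seq (nat * nat) :=
  [seq e <- allpairs pair (iota 0 n) (iota 0 n) | (e.1 < e.2) && a e.1 e.2].

Definition nedge_dist i (e : nat * nat) : nat :=
  minn (ndist i e.1) (ndist i e.2).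

(** Distinct edges have distinct vectors of distances from the members of s. *)
Definition resolving (s : seq nat) : bool :=
  uniq [seq [seq nedge_dist i e | i <- s] | e <- nedges].

(** The distances from each i to all edges form a row that is computed once;
    i and j together resolve the edges when the columns of the two-row table
    that they span are distinct. *)
Definition no_resolving_pair : bool :=
  let E := nedges in
  let rows := [seq [seq nedge_dist i e | e <- E] | i <- iota 0 n] in
  all (fun v => all (fun w => ~~ uniq (zip v w)) rows) rows.

Lemma resolving_sub (s t : seq nat) :
  {subset s <= t} -> resolving s -> resolving t.
Proof.
move=> st Rs; rewrite /resolving map_inj_in_uniq.
  by rewrite (map_uniq Rs).
move=> e f eE fE /eq_in_map ef; apply: (uniq_map_inj Rs) => //.
by apply/eq_in_map=> i /st/ef.
Qed.

Lemma no_resolving_pairP i j :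
  no_resolving_pair -> i < n -> j < n -> ~~ resolving [:: i; j].
Proof.
move=> /allP nR i_n j_n; have row k : k < n ->
    [seq nedge_dist k e | e <- nedges]
      \in [seq [seq nedge_dist k e | e <- nedges] | k <- iota 0 n].
  by move=> k_n; apply: map_f; rewrite mem_iota.
apply: contra (allP (nR _ (row i i_n)) _ (row j j_n)) => Rij.
rewrite zip_map map_inj_in_uniq ?(map_uniq Rij) // => e f eE fE [ei ej].
by apply: (uniq_map_inj Rij) => //=; rewrite ei ej.
Qed.

Lemma no_small_resolving (s : seq nat) :
  no_resolving_pair -> 0 < n -> all (gtn n) s -> size s <= 2 -> ~~ resolving s.
Proof.
move=> nR n_gt0 s_n s2; have [i [j [i_n j_n sij]]] :
    exists i j, [/\ i < n, j < n & {subset s <= [:: i; j]}].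
  case: s s_n s2 => [|i [|j [|k s]]] //=.
  - by exists 0, 0; split.
  - by case/andP=> i_n _ _; exists i, i; split=> // k; rewrite !inE => ->.
  - by case/and3P=> i_n j_n _ _; exists i, j; split=> //.
by apply: contra (resolving_sub sij) _; apply: no_resolving_pairP.
Qed.

Lemma mem_nedges e :
  (e \in nedges) = [&& e.1 < n, e.2 < n, e.1 < e.2 & a e.1 e.2].
Proof.
have -> : (e \in nedges) =
    ((e.1 < e.2) && a e.1 e.2) && ((e.1 < n) && (e.2 < n)).
  rewrite mem_filter; congr (_ && _); case: e => i j /=.
  apply/allpairsP/andP => [[[i' j'] /= [i'n j'n [-> ->]]]|[i_n j_n]].
    by move: i'n j'n; rewrite !mem_iota.
  by exists (i, j); rewrite !mem_iota.
by rewrite andbC -andbA.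
Qed.

Lemma nedges_uniq : uniq nedges.
Proof. by rewrite filter_uniq // allpairs_uniq ?iota_uniq // => -[? ?] []. Qed.

End NumberedGraph.

(** * Numberings of a graph *)

(** With P true of the lengths of simple paths between two vertices and Q of the
    radii of balls, this equates the two ways to compute a distance. *)
Lemma find_iota_first (P Q : pred nat) N :
    (forall k, reflect (exists2 m, m <= k & P m) (Q k)) ->
  find P (iota 0 N) = find Q (iota 0 N).
Proof.
move=> PQ; elim: N => // N IHN; rewrite -addn1 iotaD !find_cat.
have sPQ : has P (iota 0 N) = has Q (iota 0 N).
  apply/hasP/hasP => -[k]; rewrite mem_iota => k_N.
    by move=> Pk; exists k; rewrite ?mem_iota //; apply/PQ; exists k.
  case/PQ=> m m_k Pm; exists m; rewrite // mem_iota.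
  exact: leq_ltn_trans m_k k_N.
rewrite -sPQ IHN; case: (boolP (has P _)) => //= noP.
suff -> : P N = Q N by [].
apply/idP/PQ => [PN|[m m_N Pm]]; first by exists N.
move: m_N; rewrite leq_eqVlt => /orP[/eqP<- //|m_N].
by case/hasP: noP; exists m; rewrite // mem_iota.
Qed.

(* The lemmas on iterated operators then apply to the minimum in [edge_dist]. *)
HB.instance Definition _ := SemiGroup.isComLaw.Build nat minn minnA minnC.

(* c is a bijection onto 0, ..., n-1, and a is the adjacency of G read through c. *)
Section Numbering.

Variables (G : cgraph) (n : nat) (a : rel nat) (c : G -> nat).

Hypothesis c_inj : injective c.
Hypothesis c_im : forall i, reflect (exists x, c x = i) (i < n).
Hypothesis c_adj : forall x y : G, adj x y = a (c x) (c y).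

Lemma numbering_lt x : c x < n.
Proof. by apply/c_im; exists x. Qed.

Lemma numbering_card : #|G| = n.
Proof.
rewrite cardE -(size_map c) -(size_iota 0 n); apply/perm_size/uniq_perm.
- by rewrite map_inj_uniq ?enum_uniq.
- exact: iota_uniq.
move=> i; rewrite mem_iota /=; apply/mapP/c_im => [[x _ ->]|[x <-]].
  by exists x.
by exists x; rewrite ?mem_enum.
Qed.

Lemma mem_ball k x y :
  reflect (exists p, [/\ path (@adj G) x p, last x p = y & size p <= k])
          (c y \in ball n a k (c x)).
Proof.
elim: k y => [|k IHk] y; rewrite /ball /=.
  rewrite inE (inj_eq c_inj); apply: (iffP eqP) => [->|[p [_ <-]]].
    by exists [::].
  by rewrite leqn0 size_eq0 => /eqP->.
rewrite mem_filter mem_iota /= numbering_lt !andbT -/(ball n a k (c x)).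
apply: (iffP orP) => [[/IHk[p [xp py pk]]|/hasP[i]]|[p]].
- by exists p; rewrite ltnW.
- move=> iB; have /c_im[z zi] : i < n.
    move: iB; case: (k) => [|m]; rewrite /ball /=.
      by rewrite inE => /eqP->; apply: numbering_lt.
    by rewrite mem_filter mem_iota => /andP[_].
  rewrite -zi -c_adj in iB *; move/IHk: iB => [p [xp pz pk]] zy.
  by exists (rcons p y); rewrite rcons_path xp pz last_rcons size_rcons.
case: (lastP p) => [|{}p z]; first by case=> _ <- _; left; apply/IHk; exists [::].
rewrite rcons_path last_rcons size_rcons => -[/andP[xp pz] <- pk].
right; apply/hasP; exists (c (last x p)); last by rewrite -c_adj.
by apply/IHk; exists p.
Qed.

Lemma dist_numbering x y : dist x y = ndist n a (c x) (c y).
Proof.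
rewrite /dist /ndist numbering_card; apply: find_iota_first => k.
apply: (iffP (mem_ball k x y)) => [[p [xp <- pk]]|[m mk /existsP[p]]].
  case: (shortenP xp) => p' xp' Up' sp'.
  exists (size p').
    by apply: leq_trans pk; apply: uniq_leq_size sp'; case/andP: Up'.
  by apply/existsP; exists (in_tuple p'); rewrite xp' Up' eqxx.
by case/and3P=> xp _ /eqP py; exists p; rewrite size_tuple.
Qed.

(** The edge of G, a set of vertices, whose endpoints have the given numbers. *)
Definition numbered_edge (e : nat * nat) : {set G} :=
  [set x | c x \in [:: e.1; e.2]].

Lemma numbered_edgeE x y : numbered_edge (c x, c y) = [set x; y].
Proof. by apply/setP=> z; rewrite !inE !(inj_eq c_inj). Qed.

Lemma nedgesP e :
  reflect (exists x y, [/\ e = (c x, c y), c x < c y & adj x y])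
          (e \in nedges n a).
Proof.
rewrite mem_nedges; case: e => i j /=; apply: (iffP and4P).
  by case=> /c_im[x <-] /c_im[y <-] xy; rewrite -c_adj; exists x, y.
by case=> x [y [[-> ->] xy]]; rewrite -c_adj !numbering_lt.
Qed.

Lemma edges_numbering f :
  reflect (exists2 e, e \in nedges n a & f = numbered_edge e) (f \in edges G).
Proof.
apply: (iffP imsetP) => [[[x y] /[!inE]/= xy ->]|[_ /nedgesP[x [y [-> _ xy]]] ->]].
  case: (ltngtP (c x) (c y)) => [lt_xy|lt_yx|/c_inj exy].
  - exists (c x, c y); last by rewrite numbered_edgeE.
    by apply/nedgesP; exists x, y.
  - exists (c y, c x); last by rewrite numbered_edgeE setUC.
    by apply/nedgesP; exists y, x; rewrite adj_sym.
  - by rewrite exy adj_irrefl in xy.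
by exists (x, y); rewrite ?inE // numbered_edgeE.
Qed.

Lemma numbered_edge_inj : {in nedges n a &, injective numbered_edge}.
Proof.
move=> _ _ /nedgesP[x [y [-> xy _]]] /nedgesP[z [t [-> zt _]]].
rewrite !numbered_edgeE => /setP E.
have := E x; rewrite !inE eqxx => /esym/orP[]/eqP ex;
have := E y; rewrite !inE eqxx orbT => /esym/orP[]/eqP ey; subst.
- by rewrite ltnn in xy.
- by [].
- by have := ltn_trans xy zt; rewrite ltnn.
- by rewrite ltnn in xy.
Qed.

Lemma card_edges_numbering : #|edges G| = size (nedges n a).
Proof.
have -> : edges G = [set f in map numbered_edge (nedges n a)].
  apply/setP=> f; rewrite inE.
  by apply/edges_numbering/mapP => -[e ? ?]; exists e.
rewrite cardsE (card_uniqP _) ?size_map //.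
by rewrite map_inj_in_uniq ?nedges_uniq //; apply: numbered_edge_inj.
Qed.

Lemma edge_dist_numbering x e :
  e \in nedges n a -> edge_dist x (numbered_edge e) = nedge_dist n a (c x) e.
Proof.
case/nedgesP=> y [z [-> yz _]]; rewrite numbered_edgeE /edge_dist.
have neq_yz : y != z by apply: contraTneq yz => ->; rewrite ltnn.
(* The default value #|G| of the minimum is absorbed, being above the distances. *)
rewrite -big_enum (perm_big [:: y; z]) /=; last first.
  apply: uniq_perm; rewrite ?enum_uniq //= ?inE ?neq_yz // => t.
  by rewrite mem_enum !inE.
rewrite !big_cons big_nil !dist_numbering /nedge_dist /=; congr minn.
by apply/minn_idPl; rewrite numbering_card -{2}(size_iota 0 n) find_size.
Qed.

Lemma edge_metric_generator_numbering (S : {set G}) (s : seq nat) :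
  map c (enum S) =i s -> edge_metric_generator S = resolving n a s.
Proof.
move=> Ss; rewrite /resolving; apply/idP/idP => [gS|Us].
  rewrite map_inj_in_uniq ?nedges_uniq // => e f eE fE /eq_in_map ef.
  apply/eqP; apply: contraT => nef.
  have /forall_inP/(_ (numbered_edge e)) := gS.
  move=> /(_ (introT (edges_numbering _) (ex_intro2 _ _ e eE erefl))).
  move/forall_inP/(_ (numbered_edge f)).
  move=> /(_ (introT (edges_numbering _) (ex_intro2 _ _ f fE erefl))).
  rewrite (inj_in_eq numbered_edge_inj) // nef /= => /exists_inP[x xS].
  rewrite /distinguishes !edge_dist_numbering // ef ?eqxx // -Ss.
  by rewrite map_f ?mem_enum.
apply/forall_inP=> _ /edges_numbering[e eE ->].
apply/forall_inP=> _ /edges_numbering[f fE ->]; apply/implyP=> nef.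
apply: contraT => /exists_inPn noS; case/negP: nef; apply/eqP.
congr numbered_edge.
apply: (uniq_map_inj Us) => //; apply/eq_in_map=> i.
rewrite -Ss => /mapP[x]; rewrite mem_enum => xS ->.
by rewrite -!edge_dist_numbering //; apply/eqP/negPn/noS.
Qed.

(** A resolving list bounds the dimension above, and the dimension is itself the
    size of some resolving list. *)
Lemma edim_numbering (s : seq nat) :
    all (gtn n) s -> resolving n a s ->
  edim G <= size s /\
  exists t, [/\ all (gtn n) t, size t = edim G & resolving n a t].
Proof.
move=> /allP s_n Rs; pose S := [set x | c x \in s].
have Ss : map c (enum S) =i s.
  move=> i; apply/mapP/idP => [[x]|i_s]; first by rewrite mem_enum inE => ? ->.
  by have /c_im[x xi] := s_n i i_s; exists x; rewrite // mem_enum inE xi.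
have gS : edge_metric_generator S by rewrite (edge_metric_generator_numbering Ss).
(* [edim] is a minimum taken from the full vertex set, so this set has to be a
   generator. *)
have gT : edge_metric_generator [set: G].
  apply/forall_inP=> e eE; apply/forall_inP=> f fE; apply/implyP=> nef.
  move/forall_inP/(_ e eE)/forall_inP/(_ f fE)/implyP/(_ nef): gS.
  by case/exists_inP=> x _ xef; apply/exists_inP; exists x.
rewrite /edim; case: arg_minnP => // T gT' minT; split.
  apply: leq_trans (minT S gS) _.
  rewrite cardE -(size_map c) uniq_leq_size ?map_inj_uniq ?enum_uniq // => i.
  by rewrite Ss.
exists (map c (enum T)); rewrite size_map -cardE; split=> //.
  by apply/allP=> _ /mapP[x _ ->]; apply: numbering_lt.
by rewrite -(@edge_metric_generator_numbering T).
Qed.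

End Numbering.

(** * Theta graphs *)

Section NumberedTheta.

(** i is immediately followed by j in s. *)
Definition npath_edge (s : seq nat) : rel nat :=
  fun i j => (i, j) \in zip s (behead s).

Variables p q r : nat.

(** The branch vertices u and v are 0 and 1, and the inner vertices of the three
    branches come next, branch by branch, in order from u to v. *)
Definition nbranches : seq (seq nat) :=
  [:: 0 :: rcons (iota 2 p.-1) 1;
      0 :: rcons (iota (2 + p.-1) q.-1) 1;
      0 :: rcons (iota (2 + p.-1 + q.-1) r.-1) 1].

Definition ntheta : rel nat := fun i j =>
  has (fun s => npath_edge s i j || npath_edge s j i) nbranches.

Definition theta_order := 2 + p.-1 + q.-1 + r.-1.

(** The numbering that [nbranches] describes; u and v are [inl true] and
    [inl false], whence the negation. *)
Definition theta_num (x : theta p q r) : nat :=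
  match x with
  | inl b => ~~ b
  | inr (inl (inl i)) => 2 + i
  | inr (inl (inr i)) => 2 + p.-1 + i
  | inr (inr i) => 2 + p.-1 + q.-1 + i
  end.

Lemma theta_num_inj : injective theta_num.
Proof.
have ltD m k (i : 'I_k) j : m + i = m + k + j -> False.
  move/eqP; rewrite -addnA eqn_add2l => /eqP ij.
  by have := ltn_ord i; rewrite ij ltnNge leq_addr.
move=> [b|[[i|i]|i]] [b'|[[j|j]|j]] //=.
- by case: b b' => -[].
- by case: b.
- by case: b.
- by case: b.
- by case: b'.
- by move/addnI/val_inj->.
- by move/ltD.
- by rewrite -addnA => /ltD.
- by case: b'.
- by move/esym/ltD.
- by move/addnI/val_inj->.
- by move/ltD.
- by case: b'.
- by rewrite -addnA => /esym/ltD.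
- by move/esym/ltD.
- by move/addnI/val_inj->.
Qed.

Lemma theta_num_im i : reflect (exists x, theta_num x = i) (i < theta_order).
Proof.
have ltD m k l : l < m + k -> l < m \/ exists j : 'I_k, m + j = l.
  case: (ltnP l m) => [|ml]; [by left | rewrite -ltn_subLR // => lk; right].
  by exists (Ordinal lk); rewrite /= subnKC.
apply: (iffP idP) => [|[[b|[[j|j]|j]] <-]].
- case/ltD=> [/ltD[/ltD[|[j <-]]|[j <-]]|[j <-]].
  + by case: i => [|[]] // _; [exists (inl true) | exists (inl false)].
  + by exists (inr (inl (inl j))).
  + by exists (inr (inl (inr j))).
  + by exists (inr (inr j)).
- by rewrite /theta_order -!addnA; case: b.
- by rewrite /theta_order /= -!addnA ltn_add2l ltn_addr.
- by rewrite /theta_order /= -!addnA !ltn_add2l ltn_addr.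
- by rewrite /theta_order /= -!addnA !ltn_add2l.
Qed.

Lemma theta_num_branches :
  map (map theta_num) (theta_branches p q r) = nbranches.
Proof.
have branch m k (g : 'I_k -> theta_vertex p q r) :
    (forall i, theta_num (g i) = m + i) ->
  map theta_num (theta_branch g) = 0 :: rcons (iota m k) 1.
  move=> gE; rewrite /= map_rcons -map_comp (eq_map gE).
  by rewrite (map_comp (addn m)) val_enum_ord -iotaDl addn0.
by congr [:: _; _; _]; apply: branch.
Qed.

Lemma theta_num_adj (x y : theta p q r) :
  adj x y = ntheta (theta_num x) (theta_num y).
Proof.
rewrite /ntheta -theta_num_branches has_map; apply: eq_has => s /=.
have E z t : npath_edge (map theta_num s) (theta_num z) (theta_num t)
    = consecutive s z t.
  rewrite /npath_edge behead_map zip_map_pair.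
  apply: (mem_map (f := fun zt => _) _ _ (z, t)) => -[z1 t1] [z2 t2] /= [].
  by move=> /theta_num_inj-> /theta_num_inj->.
by rewrite !E.
Qed.

(** All that is left to evaluate: the graph has one more edge than vertices, s is a
    resolving list of three vertices, and no two vertices are resolving. *)
Definition edim3_certificate (s : seq nat) : bool :=
  [&& size (nedges theta_order ntheta) == theta_order.+1,
      no_resolving_pair theta_order ntheta,
      all (gtn theta_order) s, resolving theta_order ntheta s & size s == 3].

Lemma edim3_certificateP (G : cgraph) (s : seq nat) :
    isomorphic G (theta p q r) -> edim3_certificate s ->
  edim G = 2 * cyclomatic G - 1.
Proof.
case=> f f_bij f_adj /and5P[/eqP sE noR s_n Rs /eqP s3].
pose c := theta_num \o f.
have c_inj : injective c by apply: inj_comp theta_num_inj (bij_inj f_bij).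
have c_im i : reflect (exists x, c x = i) (i < theta_order).
  apply: (iffP (theta_num_im i)) => [[y <-]|[x <-]]; last by exists (f x).
  by case: f_bij => g _ gK; exists (g y); rewrite /c /= gK.
have c_adj x y : adj x y = ntheta (c x) (c y) by rewrite -theta_num_adj f_adj.
have [le3 [t [t_n t_s Rt]]] := edim_numbering c_inj c_im c_adj s_n Rs.
rewrite /cyclomatic (card_edges_numbering c_inj c_im c_adj) sE.
rewrite (numbering_card c_inj c_im) addn1 -(addn2 theta_order) addKn.
apply/eqP; rewrite (_ : 2 * 2 - 1 = 3) // eqn_leq -{1}s3 le3 ltnNge -t_s.
by apply: contraL Rt; apply: no_small_resolving; rewrite // /theta_order -!addnA.
Qed.

End NumberedTheta.

Theorem corollary12 (G : cgraph) :
  isomorphic G (theta 1 2 2) \/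
  (exists p q : nat,
    [/\ 2 <= p <= 3, p <= q <= p + 2 & isomorphic G (theta p p q)]) ->
  edim G = 2 * cyclomatic G - 1.
Proof.
case=> [isoG|[p [q [p23 q_p isoG]]]].
  (* 2 and 3 are the inner vertices of the two branches of length 2. *)
  by apply: (edim3_certificateP (s := [:: 0; 2; 3]) isoG); vm_compute.
(* 2 and p + 1 follow u on the two branches of length p. *)
apply: (edim3_certificateP (s := [:: 0; 2; p.+1]) isoG).
have pq : (p, q) \in [:: (2, 2); (2, 3); (2, 4); (3, 3); (3, 4); (3, 5)].
  case: p p23 q_p {isoG} => [|[|[|[|p]]]] // _;
    by case: q => [|[|[|[|[|[|q]]]]]].
pose certified pq := edim3_certificate pq.1 pq.1 pq.2 [:: 0; 2; pq.1.+1].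
suff /allP/(_ _ pq) :
    all certified [:: (2, 2); (2, 3); (2, 4); (3, 3); (3, 4); (3, 5)] by [].
by vm_compute.
Qed.
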